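(* Let $n\ge4$ be an even integer and let $a_0,a_1,\dots,a_n$ be integers with $a_i\ge2$ for every $i$. For $0\le i\le n$ define $$v_i=1-a_{i+1}+a_{i+1}a_{i+2}-\cdots+a_{i+1}a_{i+2}\cdots a_{i+n-1}a_{i+n},$$ where the subscripts are taken modulo $n+1$. Then $$1+a_0a_1\cdots a_n<\left(\frac{n+2}{n+1}\right)\min_{i\neq j}\{v_iv_j\}.$$
   Context: Each $v_i$ is the alternating sum $\sum_{k=0}^{n}(-1)^k\prod_{l=1}^{k}a_{i+l}$ with indices modulo $n+1$ (the empty product is $1$). *)

(* Defs.v *)
From mathcomp Require Import all_boot all_order all_algebra.

Set Implicit Arguments.
Unset Strict Implicit.
Unset Printing Implicit Defensive.

Import Order.TTheory GRing.Theory Num.Theory.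
Local Open Scope ring_scope.

(* [inZp m : 'I_n.+1] is m reduced modulo n + 1. *)
Definition altsum (n : nat) (a : 'I_n.+1 -> int) (i : 'I_n.+1) : int :=
  \sum_(0 <= k < n.+1) (-1) ^+ k * \prod_(1 <= l < k.+1) a (inZp (i + l)).

(* The initial value of the iterated minimum is the product for the pair
   (0, n), a member of the family as soon as n > 0, so this is the genuine
   minimum over i <> j; for n = 0 there are no such pairs and the value is
   meaningless. *)
Definition min_pair_prod (n : nat) (v : 'I_n.+1 -> int) : int :=
  \big[Order.min/v ord0 * v ord_max]_(p : 'I_n.+1 * 'I_n.+1 | p.1 != p.2)
    (v p.1 * v p.2).

(* Main.v *)
Require Import Defs.
From mathcomp Require Import all_boot all_order all_algebra.
From mathcomp Require Import zify.

Import Order.TTheory GRing.Theory Num.Theory.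
Local Open Scope ring_scope.

(** Let [P] be the product of all the [a_i]. Grouping the terms of [v_i] two by
    two shows that [v_i] is at least half of its last term [P / a_i]. Since at
    least three factors, each at least [2], remain besides [a_i] and [a_j], we
    have [8 a_i a_j <= P], so [v_i v_j >= P^2 / (4 a_i a_j) >= 2 P >= 1 + P]. *)

Lemma alt_sum_prod_ge (x : nat -> int) (m : nat) (x_ge2 : forall l, 2 <= x l) :
  \prod_(1 <= l < m.*2.+1) x l
    <= 2 * \sum_(0 <= k < m.*2.+1) (-1) ^+ k * \prod_(1 <= l < k.+1) x l.
Proof.
elim: m => [|m IHm]; first by rewrite big_nat1 !big_geq.
rewrite doubleS (big_nat_recr m.*2.+2 0%N) // (big_nat_recr m.*2.+1 0%N) //=.
rewrite !(big_nat_recr m.*2.+2 1%N) // !(big_nat_recr m.*2.+1 1%N) //=.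
have A_ge0 : 0 <= \prod_(1 <= l < m.*2.+1) x l.
  by apply: prodr_ge0 => l _; apply: le_trans (x_ge2 l).
rewrite !exprS -signr_odd odd_double expr0.
move: IHm A_ge0 (x_ge2 m.*2.+1) (x_ge2 m.*2.+2).
move: (\prod_(1 <= l < _) _) (\sum_(0 <= k < _) _) => A S.
move: (x m.*2.+1) (x m.*2.+2) => y z ? ? ? ?.
(* The new pair of terms is [- A * y + A * y * z], so the goal amounts to
   [0 <= 2 * S + A * y * (z - 2)], with [0 <= A <= 2 * S] by induction. *)
have : 0 <= A * (y * (z - 2)) by rewrite !mulr_ge0 //; lia.
lia.
Qed.

(** Translation by [i] permutes the residues modulo [n + 1]; the shift [0] contributes the factor
    [a i]. *)
Lemma prod_shift (n : nat) (a : 'I_n.+1 -> int) (i : 'I_n.+1) :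
  a i * \prod_(1 <= l < n.+1) a (inZp (i + l)) = \prod_j a j.
Proof.
rewrite [RHS](reindex_inj (addrI i)) big_ord_recl big_add1 big_mkord addr0.
by congr (_ * _); apply: eq_bigr => j _; congr (a _); apply: val_inj.
Qed.

(** The factor [a i] clears the denominator of [P / a_i], keeping the bound in [int]. *)
Lemma altsum_ge (n : nat) (a : 'I_n.+1 -> int) (i : 'I_n.+1) :
  ~~ odd n -> (forall j, 2 <= a j) ->
  \prod_j a j <= 2 * (a i * altsum a i).
Proof.
move=> n_even a_ge2; rewrite -(prod_shift _ a i) mulrCA ler_wpM2l //.
  exact: le_trans (a_ge2 i).
have := alt_sum_prod_ge (fun l => a (inZp (i + l))) n./2 (fun l => a_ge2 _).
by rewrite even_halfK.
Qed.

Lemma prod_ge_pair (n : nat) (a : 'I_n.+1 -> int) (i j : 'I_n.+1) :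
  (4 <= n)%N -> (forall k, 2 <= a k) -> i != j ->
  8 * (a i * a j) <= \prod_k a k.
Proof.
move=> n_ge4 a_ge2 neq_ij.
rewrite (bigD1 i) //= (bigD1 j) 1?eq_sym //= [8 * _]mulrC [leRHS]mulrA.
have ai := a_ge2 i; have aj := a_ge2 j.
apply: ler_wpM2l; first by rewrite mulr_ge0 //; lia.
apply: (@le_trans _ _ (\prod_(k < n.+1 | (k != i) && (k != j)) 2)); last first.
  by apply: ler_prod => k _; rewrite a_ge2.
rewrite prodr_const -[8]/(2 ^+ 3 : int) ler_eXn2l //.
(* The exponent is the size of the complement of [{i, j}], namely [n - 1 >= 3]. *)
have := cardsC [set i; j]; rewrite cards2 neq_ij card_ord.
rewrite (eq_card (B := ~: [set i; j])); last by move=> k; rewrite !inE negb_or.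
lia.
Qed.

Lemma altsum_mul_ge (n : nat) (a : 'I_n.+1 -> int) (i j : 'I_n.+1) :
  (4 <= n)%N -> ~~ odd n -> (forall k, 2 <= a k) -> i != j ->
  1 + \prod_k a k <= altsum a i * altsum a j.
Proof.
move=> n_ge4 n_even a_ge2 neq_ij.
have := prod_ge_pair _ _ _ _ n_ge4 a_ge2 neq_ij.
have := altsum_ge _ _ i n_even a_ge2; have := altsum_ge _ _ j n_even a_ge2.
move: (a_ge2 i) (a_ge2 j); move: (\prod_k _) (altsum a i) (altsum a j) => P v w.
move: (a i) (a j) => b c b2 c2 Pw Pv Pbc.
have bc_gt0 : 0 < b * c by apply: mulr_gt0; lia.
have P_ge0 : 0 <= P by lia.
have PP : P * P <= (2 * (b * v)) * (2 * (c * w)) by apply: ler_pM.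
have PPbc : 8 * (b * c) * P <= P * P by apply: ler_wpM2r.
(* Both sides are separated by [P * P]; cancelling [4 * (b * c)] leaves [2 * P <= v * w], and
   [1 <= P]. *)
have : 4 * (b * c) * (2 * P) <= 4 * (b * c) * (v * w) by lia.
rewrite ler_pM2l; lia.
Qed.

Theorem lemma6p2 (n : nat) (a : 'I_n.+1 -> int)
  (n_ge4 : (4 <= n)%N) (n_even : ~~ odd n)
  (a_ge2 : forall i : 'I_n.+1, 2 <= a i) :
  (1 + \prod_(i < n.+1) a i)%:~R
    < (n + 2)%:R / (n + 1)%:R * (min_pair_prod (altsum a))%:~R :> rat.
Proof.
have vv_ge := altsum_mul_ge _ _ _ _ n_ge4 n_even a_ge2.
have min_ge : 1 + \prod_i a i <= min_pair_prod (altsum a).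
  rewrite /min_pair_prod; apply: (big_ind (fun x => _ <= x)) => [|x y hx hy|p]; last exact: vv_ge.
    (* The initial value comes from the indices [0] and [n], distinct since [n > 0]. *)
    by apply: vv_ge; rewrite -val_eqE /=; lia.
  by rewrite le_min hx.
have P_gt0 : 0 < 1 + \prod_i a i.
  by apply: ltr_pwDl => //; apply: prodr_ge0 => i _; apply: le_trans (a_ge2 i).
(* Strictness comes from [(n + 2) / (n + 1) > 1] and the positivity of the minimum. *)
apply: (@le_lt_trans _ _ (min_pair_prod (altsum a))%:~R); first by rewrite ler_int.
rewrite ltr_pMl ?ltr0z ?(lt_le_trans P_gt0) //.
by rewrite ltr_pdivlMr ?mul1r ?ltr_nat ?ltr0n; lia.
Qed.
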